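(* Let $\mathfrak t$ be a semibounded sesquilinear form in a complex Hilbert space $\mathfrak H$, let $c \le m(\mathfrak t)$, and let $Q_c$ be a representing map for $\mathfrak t - c$, i.e. a linear operator from $\mathfrak H$ to a Hilbert space $\mathfrak K$ with $\operatorname{dom} Q_c=\operatorname{dom}\mathfrak t$ and $$\mathfrak t[\varphi,\psi]-c(\varphi,\psi)_{\mathfrak H}=(Q_c\varphi,Q_c\psi)_{\mathfrak K},\qquad \varphi,\psi\in\operatorname{dom}\mathfrak t .$$ Then: (a) $\mathfrak t$ is closable if and only if $Q_c$ is closable; (b) $\mathfrak t$ is closed if and only if $Q_c$ is closed.
   Context: A (sesquilinear) form $\mathfrak t$ in $\mathfrak H$ is a map $\operatorname{dom}\mathfrak t\times\operatorname{dom}\mathfrak t\to\mathbb C$, linear in the first and antilinear in the second entry, where $\operatorname{dom}\mathfrak t$ is a (not necessarily dense) linear subspace of $\mathfrak H$; $\mathfrak t[\varphi]=\mathfrak t[\varphi,\varphi]$. It is semibounded if there is $c\in\mathbb R$ with $\mathfrak t[\varphi]\ge c\|\varphi\|^2$ for all $\varphi\in\operatorname{dom}\mathfrak t$; the greatest such $c$ is the lower bound $m(\mathfrak t)\in\mathbb R$ (so $\operatorname{dom}\mathfrak t\neq\{0\}$ is understood). For $\varphi_n\in\operatorname{dom}\mathfrak t$ and $\varphi\in\mathfrak H$, $\varphi_n\to_{\mathfrak t}\varphi$ means $\varphi_n\to\varphi$ in $\mathfrak H$ and $\mathfrak t[\varphi_n-\varphi_m]\to0$ as $n,m\to\infty$.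 The form $\mathfrak t$ is closable if for every sequence $\varphi_n\in\operatorname{dom}\mathfrak t$, $\varphi_n\to_{\mathfrak t}0$ implies $\mathfrak t[\varphi_n]\to0$; it is closed if for every sequence $\varphi_n\in\operatorname{dom}\mathfrak t$, $\varphi_n\to_{\mathfrak t}\varphi$ implies $\varphi\in\operatorname{dom}\mathfrak t$ and $\mathfrak t[\varphi_n-\varphi]\to0$. An operator is closed if its graph is closed and closable if the closure of its graph is the graph of an operator. *)

(* Defs.v *)
From HB Require Import structures.
From mathcomp Require Import all_boot all_order all_algebra.
From mathcomp Require Import sesquilinear complex.
From mathcomp Require Import all_classical all_reals topology.
From mathcomp Require Import normedtype.

Set Implicit Arguments.
Unset Strict Implicit.
Unset Printing Implicit Defensive.

Import Order.TTheory GRing.Theory Num.Theory.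
Import numFieldNormedType.Exports.

Local Open Scope classical_set_scope.
Local Open Scope complex_scope.
Local Open Scope ring_scope.

(* Complex Hilbert spaces over R[i], R : realType. The inner product is linear
   in its first argument and antilinear in the second ({dot _ for conj}); the
   norm, whose values lie in R[i], is real and nonnegative there. *)
HB.mixin Record NormedModule_isHilbert (R : realType) H
    of CompleteNormedModule R[i] H := {
  inner : {dot H for (@Num.conj R[i])} ;
  innerE : forall x : H, inner x x = `|x| ^+ 2 }.

#[short(type="hilbertType")]
HB.structure Definition Hilbert (R : realType) :=
  {H of CompleteNormedModule R[i] H & NormedModule_isHilbert R H}.

(* Forms and operators are total functions whose values outside of the domain
   are irrelevant. *)
Record sesqform (R : realType) (H : hilbertType R) := SesqForm {
  form_dom : submodClosed H ;
  form_fun :> H -> H -> R[i] ;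
  form_linearl : forall (a : R[i]) (x y z : H),
    x \in form_dom -> y \in form_dom -> z \in form_dom ->
    form_fun (a *: x + y) z = a * form_fun x z + form_fun y z ;
  form_antilinearr : forall (a : R[i]) (x y z : H),
    x \in form_dom -> y \in form_dom -> z \in form_dom ->
    form_fun z (a *: x + y) = Num.conj a * form_fun z x + form_fun z y }.

Record linop (R : realType) (H K : hilbertType R) := LinOp {
  op_dom : submodClosed H ;
  op_fun :> H -> K ;
  op_linear : forall (a : R[i]) (x y : H), x \in op_dom -> y \in op_dom ->
    op_fun (a *: x + y) = a *: op_fun x + op_fun y }.

Section Forms.
Context (R : realType) (H : hilbertType R).
Implicit Types (t : sesqform H) (u : nat -> H) (x : H).

(* The order of R[i] is partial: z <= w says that w - z is real and
   nonnegative, so that in particular t x x is real here. *)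
Definition form_bounded_below t (c : R) : Prop :=
  forall x, x \in form_dom t -> c%:C * `|x| ^+ 2 <= t x x.

Definition semibounded t : Prop := exists c : R, form_bounded_below t c.

(* For t semibounded with nonzero domain this is a maximum, see
   lower_boundP; on the zero domain every c is a bound and m(t) is undefined. *)
Definition lower_bound t : R := sup [set c : R | form_bounded_below t c].

Definition form_cvg t u x : Prop :=
  u n @[n --> \oo] --> x /\
  (t (u nm.1 - u nm.2) (u nm.1 - u nm.2) : R[i]^o)
    @[nm --> (\oo, \oo)] --> (0 : R[i]^o).

Definition form_closable t : Prop :=
  forall u, (forall n, u n \in form_dom t) -> form_cvg t u 0 ->
    (t (u n) (u n) : R[i]^o) @[n --> \oo] --> (0 : R[i]^o).

Definition form_closed t : Prop :=
  forall u x, (forall n, u n \in form_dom t) -> form_cvg t u x ->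
    x \in form_dom t /\
    (t (u n - x) (u n - x) : R[i]^o) @[n --> \oo] --> (0 : R[i]^o).

Lemma lower_boundP t : semibounded t ->
  (exists2 x, x \in form_dom t & x != 0) ->
  form_bounded_below t (lower_bound t) /\
  (forall c, form_bounded_below t c -> c <= lower_bound t).
Proof.
move=> [c0 hc0] [x0 x0D x0N0].
have nE x : `|x| ^+ 2 = (complex.Re (`|x| ^+ 2))%:C.
  by rewrite RRe_real// ger0_real// exprn_ge0.
have bE c x : (c%:C * `|x| ^+ 2 <= t x x) =
    (complex.Im (t x x) == 0) && (c * complex.Re (`|x| ^+ 2) <= complex.Re (t x x)).
  rewrite nE; case: (t x x) => a b /=; rewrite lecE /=.
  by rewrite !mulr0 !mul0r addr0 subr0.
have n0 : 0 < complex.Re (`|x0| ^+ 2).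
  by rewrite -ltcR -nE exprn_gt0// normr_gt0.
have hs : has_sup [set c : R | form_bounded_below t c].
  split; first by exists c0.
  exists (complex.Re (t x0 x0) / complex.Re (`|x0| ^+ 2)) => c /(_ _ x0D).
  by rewrite bE ler_pdivlMr// => /andP[].
split; last by move=> c hc; apply: ub_le_sup => //; case: hs.
move=> x xD; rewrite bE; have := hc0 _ xD; rewrite bE => /andP[-> h0] /=.
have [xN0|] := ltP 0 (complex.Re (`|x| ^+ 2)); last first.
  rewrite -lecR -nE => h; suff -> : complex.Re (`|x| ^+ 2) = 0.
    have e : `|x| ^+ 2 = 0 by apply/eqP; rewrite eq_le h exprn_ge0.
    by move: h0; rewrite e /= !mulr0.
  by have -> : `|x| ^+ 2 = 0 by apply/eqP; rewrite eq_le h exprn_ge0.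
rewrite -ler_pdivlMr//; apply: ge_sup; first by case: hs.
by move=> c /(_ _ xD); rewrite bE ler_pdivlMr// => /andP[].
Qed.

End Forms.

Section Operators.
Context (R : realType) (H K : hilbertType R).
Implicit Types (T S : linop H K) (t : sesqform H).

Definition op_graph T : set (H * K) :=
  [set p | p.1 \in op_dom T /\ p.2 = T p.1].

Definition op_closed T : Prop := closed (op_graph T).

Definition op_closable T : Prop :=
  exists S, closure (op_graph T) = op_graph S.

Definition representing_map t (c : R) T : Prop :=
  op_dom T =i form_dom t /\
  forall x y, x \in form_dom t -> y \in form_dom t ->
    t x y - c%:C * inner x y = inner (T x) (T y).

End Operators.

(* Main.v *)
(* On dom t one has t[x] = c |x|^2 + |Q x|^2, so along sequences v_n -> 0 in
   dom t, t[v_n] -> 0 means exactly Q v_n -> 0. Since K is complete, u_n ->_t x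
   therefore says that u_n -> x and Q u_n converges to some k, i.e. that (x, k)
   is the limit of the points (u_n, Q u_n) of the graph of Q. Both equivalences
   are then read off the closure of that graph; Q is closable if and only if
   (0, k) in this closure forces k = 0. *)

Require Import Defs.
From HB Require Import structures.
From mathcomp Require Import all_boot all_order all_algebra.
From mathcomp Require Import sesquilinear complex.
From mathcomp Require Import all_classical all_reals topology normedtype.
From mathcomp Require Import interval_inference.

Import Order.TTheory GRing.Theory Num.Theory.
Import numFieldNormedType.Exports.

Local Open Scope classical_set_scope.
Local Open Scope complex_scope.
Local Open Scope ring_scope.

(* R[i] is not an archiRealFieldType, so near_infty_natSinv_lt does not apply. *)
Lemma near_infty_natSinv_ltC (R : realType) (e : R[i]) : 0 < e ->
  \forall n \near \oo, (n.+1%:R^-1 : R)%:C < e.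
Proof.
case: e => a b; rewrite ltcE /= => /andP[/eqP -> a0].
near=> n; rewrite ltcR.
near: n; exact: (near_infty_natSinv_lt (PosNum a0)).
Unshelve. all: by end_near. Qed.

(** Balls of radius [1/(n+1)] form a countable neighbourhood basis, so choosing a point of [A] in
    each one gives the sequence. The radii are embedded reals because balls here are indexed by
    [R[i]]. *)
Lemma closure_pair_seqP (R : realType) (V W : normedModType R[i])
    (A : set (V * W)) x y :
  closure A (x, y) <->
  exists2 p : nat -> V * W, (forall n, A (p n)) &
    (p n).1 @[n --> \oo] --> x /\ (p n).2 @[n --> \oo] --> y.
Proof.
split=> [clA|[p pA [px py]] U].
  have /choice[p pP] (n : nat) :
      exists q, A q /\ ball (x, y) (n.+1%:R^-1 : R)%:C q.
    have e0 : 0 < (n.+1%:R^-1 : R)%:C by rewrite ltcR invr_gt0.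
    by have [q [? ?]] := clA _ (nbhsx_ballx (x, y) _ e0); exists q.
  exists p => [n|]; first by have [] := pP n.
  split; apply/cvg_ballP => e e0; near=> n;
    have [_ [b1 b2]] := pP n;
    [apply: le_ball b1|apply: le_ball b2]; apply: ltW; near: n;
    exact: near_infty_natSinv_ltC.
rewrite nbhsE => -[B [oB Bxy] BU].
have pxy : p n @[n --> \oo] --> (x, y).
  have -> : p = (fun n => ((p n).1, (p n).2)) by apply/funext => n; case: (p n).
  exact: cvg_pair.
have : \forall n \near \oo, B (p n) by apply: pxy; apply: open_nbhs_nbhs.
by case=> N _ /(_ N (leqnn N)) BpN; exists (p N); split; [apply: pA|apply: BU].
Unshelve. all: by end_near. Qed.

Lemma cauchy_seq_subP (R : realType) (V : completeNormedModType R[i])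
    (w : nat -> V) :
  (w nm.1 - w nm.2) @[nm --> (\oo, \oo)] --> (0 : V) <->
  exists l : V, w n @[n --> \oo] --> l.
Proof.
split=> [/cvgr0Pnorm_lt w0|[l wl]].
  suff /cvg_ex : cvg (w @ \oo) by [].
  apply/cauchy_cvgP/cauchy_ballP => e e0.
  have [[A B] /= [AN BN] AB] := w0 _ e0.
  (* A neighbourhood in the product filter contains a rectangle [A] x [B]; the images of its two
     sides under [w] are the sets witnessing the Cauchy property. *)
  exists (w @` A, w @` B) => [|[_ _] [[n An <-] [m Bm <-]]].
    by split; [apply: filterS AN|apply: filterS BN] => n ?; exists n.
  by rewrite -ball_normE /=; exact: (AB (n, m)).
rewrite -(subrr l); apply: cvgB; apply: cvg_comp wl.
  exact: cvg_fst.
exact: cvg_snd.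
Qed.

Lemma cvg_sqr_norm0P (R : realType) (V : normedModType R[i]) T
    (F : set_system T) {FF : Filter F} (f : T -> V) :
  (`|f x| ^+ 2 : R[i]^o) @[x --> F] --> (0 : R[i]^o) <->
  f x @[x --> F] --> (0 : V).
Proof.
split=> [/cvgr0Pnorm_lt f0|/norm_cvg0P f0].
  apply/cvgr0Pnorm_lt => e e0; near=> x.
  rewrite -ltr_sqr ?nnegrE ?(ltW e0)//.
  have -> : `|f x| ^+ 2 = `| `|f x| ^+ 2 | by rewrite normrX normr_id.
  near: x; apply: f0.
  by rewrite exprn_gt0.
by have := cvgM f0 f0; rewrite mulr0; exact.
Unshelve. all: by end_near. Qed.

Section LinearOperators.
Context (R : realType) (H K : hilbertType R).
Implicit Types (Q : linop H K).

Lemma op_domP Q : submod_closed (op_dom Q).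
Proof. exact: submodClosedP. Qed.

Lemma linop0 Q : Q 0 = 0.
Proof.
have [D0 _] := op_domP Q.
have := op_linear 1 D0 D0; rewrite !scale1r addr0 => /eqP.
by rewrite addrC -subr_eq subrr eq_sym => /eqP.
Qed.

Lemma linopB Q x y : x \in op_dom Q -> y \in op_dom Q -> Q (x - y) = Q x - Q y.
Proof.
by move=> xD yD; rewrite addrC -scaleN1r op_linear// scaleN1r addrC.
Qed.

Lemma op_closureP Q x k :
  closure (op_graph Q) (x, k) <->
  exists2 u : nat -> H, (forall n, u n \in op_dom Q) &
    u n @[n --> \oo] --> x /\ Q (u n) @[n --> \oo] --> k.
Proof.
rewrite closure_pair_seqP; split=> [[p pQ [px pk]]|[u uD [ux uk]]].
  exists (fun n => (p n).1) => [n|]; first by have [] := pQ n.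
  split=> //; have -> // : (fun n => Q (p n).1) = (fun n => (p n).2).
  by apply/funext => n; have [_ ->] := pQ n.
by exists (fun n => (u n, Q (u n))) => [n|]; first by split; first exact: uD.
Qed.

(** By linearity, two values over the same point differ by an element of the fibre over 0, so a
    trivial fibre there makes all fibres single-valued. *)
Lemma linear_graph_linop (G : set (H * K)) :
  G (0, 0) ->
  (forall a x k y l, G (x, k) -> G (y, l) -> G (a *: x + y, a *: k + l)) ->
  (forall k, G (0, k) -> k = 0) ->
  exists S : linop H K, op_graph S = G.
Proof.
move=> G0 Glin Gfun.
have Guniq x k l : G (x, k) -> G (x, l) -> k = l.
  move=> Gk Gl; have := Glin (-1) x l x k Gl Gk.
  by rewrite !scaleN1r addNr => /Gfun/eqP; rewrite addrC subr_eq0 => /eqP.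
(* Where the fibre over [x] is empty, [f x] is the default 0; testing [G (x, f x)] in [P] therefore
   cuts out exactly the projection of [G] to [H]. *)
pose f x := xget 0 [set k | G (x, k)].
pose P : {pred H} := fun x => `[< G (x, f x) >].
have Gf x k : G (x, k) -> G (x, f x).
  by move=> Gk; exact: (xgetPex 0 (ex_intro [set k | G (x, k)] k Gk)).
have PP : submod_closed P.
  split=> [|a x y /asboolP Gx /asboolP Gy]; apply/asboolP; first exact: Gf G0.
  exact: Gf (Glin a _ _ _ _ Gx Gy).
pose D : submodClosed H := HB.pack P (GRing.isSubmodClosed.Build _ _ P PP).
have flin (a : R[i]) x y : x \in D -> y \in D -> f (a *: x + y) = a *: f x + f y.
  move=> /asboolP Gx /asboolP Gy; have Gxy := Glin a _ _ _ _ Gx Gy.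
  exact: Guniq (Gf _ _ Gxy) Gxy.
exists (LinOp flin); apply/seteqP; split=> -[x k] /=.
  by move=> [] /= /asboolP Gx ->.
move=> Gx; split; first by apply/asboolP; exact: Gf Gx.
exact: Guniq Gx (Gf _ _ Gx).
Qed.

(** The closure of the graph is again a linear subspace, so only its fibre over 0 can prevent it
    from being the graph of an operator. *)
Lemma op_closableP Q :
  op_closable Q <-> forall k, closure (op_graph Q) (0, k) -> k = 0.
Proof.
split=> [[S clQ] k|clQ0].
  by rewrite clQ => -[_ /= ->]; exact: linop0.
have [D0 Dlin] := op_domP Q.
have [||S SQ] := @linear_graph_linop (closure (op_graph Q)) _ _ clQ0.
- by apply: subset_closure; split=> //=; rewrite linop0.
- move=> a x k y l /op_closureP[u uD [ux uk]] /op_closureP[v vD [vy vl]].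
  apply/op_closureP; exists (fun n => a *: u n + v n) => [n|]; first exact: Dlin.
  split; first by apply: cvgD => //; exact: cvgZr.
  have -> : (fun n => Q (a *: u n + v n)) = (fun n => a *: Q (u n) + Q (v n)).
    by apply/funext => n; exact: op_linear.
  by apply: cvgD => //; exact: cvgZr.
- by exists S.
Qed.

Lemma op_closedP Q :
  op_closed Q <-> forall x k, closure (op_graph Q) (x, k) ->
    x \in op_dom Q /\ k = Q x.
Proof.
rewrite /op_closed closure_id; split=> [clQ x k|clQ].
  by rewrite -clQ.
apply/seteqP; split; first exact: subset_closure.
by move=> [x k] /clQ.
Qed.

End LinearOperators.

Section RepresentingMap.
Context (R : realType) (H K : hilbertType R) (t : sesqform H) (c : R)
  (Q : linop H K).
Hypothesis Q_repr : representing_map t c Q.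

Lemma form_domB x y :
  x \in form_dom t -> y \in form_dom t -> x - y \in form_dom t.
Proof. by move=> xD yD; rewrite -scaleN1r rpredD ?rpredZ. Qed.

Lemma form_repr x : x \in form_dom t ->
  t x x = c%:C * `|x| ^+ 2 + `|Q x| ^+ 2.
Proof.
have [_ tQ] := Q_repr => xD.
by rewrite -!innerE -tQ// addrC subrK.
Qed.

(** The term [c |v|^2] vanishes in the limit. The filter is arbitrary so that the lemma covers both
    sequences and the double-indexed differences [u n - u m]. *)
Lemma form_cvg0P T (F : set_system T) {FF : Filter F} (v : T -> H) :
  (forall i, v i \in form_dom t) -> v i @[i --> F] --> (0 : H) ->
  (t (v i) (v i) : R[i]^o) @[i --> F] --> (0 : R[i]^o) <->
  Q (v i) @[i --> F] --> (0 : K).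
Proof.
move=> vD /cvg_sqr_norm0P v0; rewrite -(@cvg_sqr_norm0P R K).
have cv0 : (c%:C * `|v i| ^+ 2 : R[i]^o) @[i --> F] --> (0 : R[i]^o).
  by have := cvgM (cvg_cst (c%:C : R[i]^o)) v0; rewrite mulr0; exact.
split=> h.
  have := cvgB h cv0; rewrite subr0 => /(_ FF).
  apply: cvg_trans; apply: near_eq_cvg.
  by near=> i; rewrite fctE form_repr// addrAC subrr add0r.
have := cvgD cv0 h; rewrite addr0 => /(_ FF).
apply: cvg_trans; apply: near_eq_cvg.
by near=> i; rewrite fctE form_repr.
Unshelve. all: by end_near. Qed.

(** Applied to [u n - u m], [form_cvg0P] says that [Q (u n)] is Cauchy, and completeness of [K]
    provides the limit. *)
Lemma form_cvgP (u : nat -> H) x : (forall n, u n \in form_dom t) ->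
  form_cvg t u x <->
  u n @[n --> \oo] --> x /\ exists k : K, Q (u n) @[n --> \oo] --> k.
Proof.
have [domQ _] := Q_repr => uD.
rewrite -cauchy_seq_subP /form_cvg.
have QB : (fun nm : nat * nat => Q (u nm.1) - Q (u nm.2)) =
    (fun nm => Q (u nm.1 - u nm.2)).
  by apply/funext => nm; rewrite linopB// domQ.
rewrite QB.
have uB0 : u n @[n --> \oo] --> x ->
    u nm.1 - u nm.2 @[nm --> (\oo, \oo)] --> (0 : H).
  by move=> ux; apply/cauchy_seq_subP; exists x.
have uBD (nm : nat * nat) : u nm.1 - u nm.2 \in form_dom t by exact: form_domB.
by split=> -[ux]; rewrite (form_cvg0P _ _ _ uBD (uB0 ux)).
Qed.

Lemma form_closableP : form_closable t <-> op_closable Q.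
Proof.
have [domQ _] := Q_repr; rewrite op_closableP; split=> [tcl k|Qcl u uD].
  move=> /op_closureP[u uDQ [u0 uk]].
  have uD n : u n \in form_dom t by rewrite -domQ.
  have /tcl : form_cvg t u 0 by apply/form_cvgP => //; split=> //; exists k.
  move=> /(_ uD) /form_cvg0P => /(_ uD u0) Q0.
  exact: cvg_unique uk Q0.
move=> /form_cvgP[//|u0 [k uk]]; apply/form_cvg0P => //.
(* The limit [k] lies over 0 in the closure of the graph, hence is 0; the goal becomes the known
   convergence to [k]. *)
rewrite -(Qcl k)//; apply/op_closureP; exists u => // n.
by rewrite domQ.
Qed.

Lemma form_closedP : form_closed t <-> op_closed Q.
Proof.
have [domQ _] := Q_repr.
(* This is [form_cvg0P] for [u n - x]. It needs [x] in the domain, since only there does linearity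
   split [Q (u n - x)]. *)
have subP (u : nat -> H) x : (forall n, u n \in form_dom t) ->
    x \in form_dom t -> u n @[n --> \oo] --> x ->
    (t (u n - x) (u n - x) : R[i]^o) @[n --> \oo] --> (0 : R[i]^o) <->
    Q (u n) @[n --> \oo] --> Q x.
  move=> uD xD ux; rewrite form_cvg0P; last 2 first.
  - by move=> n; exact: form_domB.
  - exact/subr_cvg0.
  rewrite -(subr_cvg0 (fun n => Q (u n))).
  suff -> : (fun n => Q (u n - x)) = (fun n => Q (u n) - Q x) by [].
  by apply/funext => n; rewrite linopB// domQ.
rewrite op_closedP; split=> [tcl x k|Qcl u x uD].
  move=> /op_closureP[u uDQ [ux uk]].
  have uD n : u n \in form_dom t by rewrite -domQ.
  have [|xD] := tcl u x uD; first by apply/form_cvgP => //; split=> //; exists k.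
  (* Closedness of [t] gives the second limit [Q x] for [Q (u n)], which must coincide with [k]. *)
  rewrite subP// domQ => Qx; split=> //; exact: cvg_unique uk Qx.
move=> /form_cvgP[//|ux [k uk]].
have [|xD kE] := Qcl x k.
  by apply/op_closureP; exists u => // n; rewrite domQ.
by rewrite domQ in xD; split=> //; apply/subP => //; rewrite -kE.
Qed.

End RepresentingMap.

Theorem lemma2p5 (R : realType) (H K : hilbertType R) (t : sesqform H)
    (t_semibounded : semibounded t)
    (t_dom_neq0 : exists2 x : H, x \in form_dom t & x != 0)
    (c : R) (c_le : c <= lower_bound t)
    (Q : linop H K) (Q_repr : representing_map t c Q) :
  (form_closable t <-> op_closable Q) /\ (form_closed t <-> op_closed Q).
Proof. by split; [exact: form_closableP Q_repr|exact: form_closedP Q_repr]. Qed.
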